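(* Let $\mathbb{K}$ be a field of characteristic zero, let $n\ge 3$, and let $R_3$ be the $(n+2)$-dimensional Leibniz algebra over $\mathbb{K}$ with basis $\{e_1,\dots,e_n,x,y\}$ and multiplication $$[e_1,e_1]=e_3,\qquad [e_i,e_1]=e_{i+1}\ (3\le i\le n-1),\qquad [e_1,x]=e_1,\qquad [x,e_1]=-e_1,$$ $$[e_i,x]=(i-1)e_i\ (3\le i\le n),\qquad [e_2,y]=e_2,$$ all other products of basis elements being zero. Then every local automorphism of $R_3$ is an automorphism of $R_3$.
   Context: A Leibniz algebra over $\mathbb{K}$ is a $\mathbb{K}$-vector space $L$ with a bilinear product $[-,-]$ satisfying $[[x,y],z]=[[x,z],y]+[x,[y,z]]$ for all $x,y,z\in L$. An automorphism of an algebra $A$ is a bijective linear map $\varphi:A\to A$ with $\varphi([u,v])=[\varphi(u),\varphi(v)]$ for all $u,v\in A$. A linear map $\Phi:A\to A$ is called a local automorphism if for every $u\in A$ there exists an automorphism $\varphi_u:A\to A$ (depending on $u$) such that $\Phi(u)=\varphi_u(u)$. *)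

(* Defs.v *)
From HB Require Import structures.
From mathcomp Require Import all_boot all_order all_algebra.
From mathcomp Require Import zify ring.

Set Implicit Arguments.
Unset Strict Implicit.
Unset Printing Implicit Defensive.

Import GRing.Theory.
Local Open Scope ring_scope.

(* (Right) Leibniz algebras over K, of arbitrary dimension. *)
Record leibnizAlg (K : fieldType) := LeibnizAlg {
  leib_car :> lmodType K;
  leib_br : leib_car -> leib_car -> leib_car;
  leib_linl : forall v, linear (fun u => leib_br u v);
  leib_linr : forall u, linear (leib_br u);
  leib_id : forall x y z,
    leib_br (leib_br x y) z = leib_br (leib_br x z) y + leib_br x (leib_br y z)
}.
Arguments leib_br {K l} _ _.

Definition automorphism (K : fieldType) (A : leibnizAlg K)
    (phi : {linear A -> A}) : Prop :=
  bijective phi /\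
  forall u v : A, phi (leib_br u v) = leib_br (phi u) (phi v).

Definition local_automorphism (K : fieldType) (A : leibnizAlg K)
    (Phi : {linear A -> A}) : Prop :=
  forall u : A, exists phi : {linear A -> A},
    automorphism phi /\ Phi u = phi u.

(* Basis vectors are labelled as on paper, with e_i indexed from 1. In
   coordinates, e_1, ..., e_n, x, y sit at positions 0, ..., n - 1, n, n + 1. *)
Inductive R3_label := E of nat | X | Y.

Definition R3_label_of (n : nat) (p : 'I_n.+2) : R3_label :=
  if (p < n)%N then E p.+1 else if p == n :> nat then X else Y.

(* This is the vector e_i only for 1 <= i <= n. *)
Definition R3_e (K : fieldType) (n i : nat) : 'rV[K]_n.+2 :=
  \row_j (j.+1 == i :> nat)%:R.

Definition R3_table (K : fieldType) (n : nat) (a b : R3_label) : 'rV[K]_n.+2 :=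
  match a, b with
  | E 1, E 1 => R3_e K n 3
  | E i, E 1 => if (3 <= i <= n - 1)%N then R3_e K n i.+1 else 0
  | E 1, X => R3_e K n 1
  | X, E 1 => - R3_e K n 1
  | E i, X => if (3 <= i <= n)%N then (i - 1)%:R *: R3_e K n i else 0
  | E 2, Y => R3_e K n 2
  | _, _ => 0
  end.

Definition R3_br (K : fieldType) (n : nat) (u v : 'rV[K]_n.+2) : 'rV[K]_n.+2 :=
  \sum_(p < n.+2) \sum_(q < n.+2)
    (u 0 p * v 0 q) *: R3_table K n (R3_label_of p) (R3_label_of q).

Lemma R3_linl (K : fieldType) (n : nat) (v : 'rV[K]_n.+2) :
  linear (fun u => R3_br u v).
Proof.
move=> a u w; rewrite /R3_br scaler_sumr -big_split; apply: eq_bigr => p _ /=.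
rewrite scaler_sumr -big_split; apply: eq_bigr => q _ /=.
by rewrite !mxE mulrDl scalerDl scalerA mulrA.
Qed.

Lemma R3_linr (K : fieldType) (n : nat) (u : 'rV[K]_n.+2) : linear (R3_br u).
Proof.
move=> a v w; rewrite /R3_br scaler_sumr -big_split; apply: eq_bigr => p _ /=.
rewrite scaler_sumr -big_split; apply: eq_bigr => q _ /=.
by rewrite !mxE mulrDr scalerDl scalerA mulrCA.
Qed.

Definition R3_coord (K : fieldType) (n : nat) (u : 'rV[K]_n.+2) (k : nat) : K :=
  u 0 (inord k).

Lemma R3_sum_pick (K : fieldType) (n : nat) (u v : 'rV[K]_n.+2) (a b : nat) :
  (a < n.+2)%N -> (b < n.+2)%N ->
  \sum_(p < n.+2) \sum_(q < n.+2)
    u 0 p * v 0 q * ((p == a :> nat)%:R * (q == b :> nat)%:R) =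
  R3_coord u a * R3_coord v b.
Proof.
move=> ha hb; rewrite (bigD1 (inord a)) //= [X in _ + X]big1 ?addr0; last first.
  move=> p /eqP hp; apply: big1 => q _.
  case: eqP => [pa|_]; last by rewrite mul0r mulr0.
  by case: hp; apply: val_inj; rewrite /= inordK.
rewrite (bigD1 (inord b)) //= [X in _ + X]big1 ?addr0; last first.
  move=> q /eqP hq.
  case: (@eqP _ (q : nat) b) => [qb|_]; last by rewrite !mulr0.
  by case: hq; apply: val_inj; rewrite /= inordK.
by rewrite !inordK // !eqxx !mulr1.
Qed.

Lemma R3_coordE (K : fieldType) (n : nat) (hn : (3 <= n)%N)
    (u v : 'rV[K]_n.+2) (k : nat) : (k < n.+2)%N ->
  R3_coord (R3_br u v) k =
  if k == 0%N then R3_coord u 0 * R3_coord v n - R3_coord u n * R3_coord v 0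
  else if k == 1%N then R3_coord u 1 * R3_coord v n.+1
  else if (k < n)%N then
    R3_coord u (if k == 2%N then 0%N else k.-1) * R3_coord v 0
    + k%:R * (R3_coord u k * R3_coord v n)
  else 0.
Proof.
move=> hk.
have -> : R3_coord (R3_br u v) k = \sum_(p < n.+2) \sum_(q < n.+2)
    u 0 p * v 0 q * R3_table K n (R3_label_of p) (R3_label_of q) 0 (inord k).
  rewrite /R3_coord /R3_br summxE; apply: eq_bigr => p _.
  by rewrite summxE; apply: eq_bigr => q _; rewrite mxE.
pose F (p q : 'I_n.+2) a b : K := (p == a :> nat)%:R * (q == b :> nat)%:R.
have key (p q : 'I_n.+2) :
  R3_table K n (R3_label_of p) (R3_label_of q) 0 (inord k) =
  if k == 0%N then F p q 0%N n - F p q n 0%N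
  else if k == 1%N then F p q 1%N n.+1
  else if (k < n)%N then
    F p q (if k == 2%N then 0%N else k.-1) 0%N + k%:R * F p q k n
  else 0.
  have hp := ltn_ord p; have hq := ltn_ord q.
  rewrite /F /R3_label_of.
  move: (nat_of_ord p) (nat_of_ord q) hp hq => {}p {}q hp hq.
  have hE i : R3_e K n i 0 (inord k) = (k.+1 == i)%:R by rewrite mxE inordK.
  have h0 : (0 : 'rV[K]_n.+2) 0 (inord k) = 0 by rewrite mxE.
  have hN i : (- R3_e K n i) 0 (inord k) = - (k.+1 == i)%:R.
    by rewrite mxE hE.
  have hZ a i : (a *: R3_e K n i) 0 (inord k) = a * (k.+1 == i)%:R.
    by rewrite mxE hE.
  have hif (b : bool) (r s : 'rV[K]_n.+2) : (if b then r else s) 0 (inord k) =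
    if b then r 0 (inord k) else s 0 (inord k) by case: b.
  case: (ltngtP p n) => hpn; case: (ltngtP q n) => hqn;
  case: p hp hpn => [|[|p]] hp hpn; case: q hq hqn => [|[|q]] hq hqn;
  rewrite /= ?hif ?hN ?hZ ?hE ?h0;
  case: k hk {hE h0 hN hZ hif} => [|[|k]] hk /=;
  repeat (case: ifP => ? /=);
  repeat (case: eqP => ? /=);
  try (exfalso; lia);
  rewrite ?(mulr0, mul0r, mulr1, addr0, add0r, subr0, oppr0, sub0r) //;
  by congr (_%:R); lia.
have pick a b : (a < n.+2)%N -> (b < n.+2)%N ->
    \sum_(p < n.+2) \sum_(q < n.+2) u 0 p * v 0 q * F p q a b =
    R3_coord u a * R3_coord v b by exact: R3_sum_pick.
under eq_bigr => p _ do under eq_bigr => q _ do rewrite key.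
case: (k =P 0%N) => k0; [|case: (k =P 1%N) => k1; [|case: (ltnP k n) => kn]].
- rewrite -!pick; try lia.
  rewrite -sumrB; apply: eq_bigr => p _; rewrite -sumrB.
  by apply: eq_bigr => q _; rewrite mulrBr.
- by apply: pick; lia.
- have h : ((if k == 2%N then 0%N else k.-1) < n.+2)%N by case: ifP => _; lia.
  rewrite -!pick //; try lia.
  rewrite mulr_sumr -big_split; apply: eq_bigr => p _ /=.
  rewrite mulr_sumr -big_split; apply: eq_bigr => q _ /=.
  by rewrite mulrDr; congr (_ + _); rewrite mulrCA.
- by apply: big1 => p _; apply: big1 => q _; rewrite mulr0.
Qed.

Lemma R3_leibniz (K : fieldType) (n : nat) (hn : (3 <= n)%N)
    (u v w : 'rV[K]_n.+2) :
  R3_br (R3_br u v) w = R3_br (R3_br u w) v + R3_br u (R3_br v w).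
Proof.
apply/rowP => j; rewrite mxE.
have E0 (t : 'rV[K]_n.+2) : t 0 j = R3_coord t j by rewrite /R3_coord inord_val.
rewrite !E0; move: (nat_of_ord j) (ltn_ord j) => k hk {E0}.
have c0 (a b : 'rV[K]_n.+2) : R3_coord (R3_br a b) 0 =
    R3_coord a 0 * R3_coord b n - R3_coord a n * R3_coord b 0.
  by rewrite R3_coordE.
have cn (a b : 'rV[K]_n.+2) : R3_coord (R3_br a b) n = 0.
  by rewrite R3_coordE // ltnn; do 2 (case: eqP => [?|_]; first lia).
have cn1 (a b : 'rV[K]_n.+2) : R3_coord (R3_br a b) n.+1 = 0.
  rewrite R3_coordE //; do 2 (case: eqP => [?|_]; first lia).
  by case: ifP => // ?; lia.
have c1 (a b : 'rV[K]_n.+2) : R3_coord (R3_br a b) 1 =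
    R3_coord a 1 * R3_coord b n.+1 by rewrite R3_coordE.
case: k hk => [|[|[|[|k]]]] hk.
- rewrite !c0 !cn; ring.
- rewrite !c1 !cn1; ring.
- have c2 (a b : 'rV[K]_n.+2) : R3_coord (R3_br a b) 2 =
      R3_coord a 0 * R3_coord b 0 + 2%:R * (R3_coord a 2 * R3_coord b n).
    by rewrite R3_coordE //= hn.
  rewrite !c2 !c0 !cn; ring.
- have [h3|h3] := ltnP 3 n; last first.
    have d0 (a b : 'rV[K]_n.+2) : R3_coord (R3_br a b) 3 = 0.
      by rewrite R3_coordE //= ifN // -leqNgt.
    by rewrite !d0 addr0.
  have c2 (a b : 'rV[K]_n.+2) : R3_coord (R3_br a b) 2 =
      R3_coord a 0 * R3_coord b 0 + 2%:R * (R3_coord a 2 * R3_coord b n).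
    by rewrite R3_coordE ?hn //=; lia.
  have c3 (a b : 'rV[K]_n.+2) : R3_coord (R3_br a b) 3 =
      R3_coord a 2 * R3_coord b 0 + 3%:R * (R3_coord a 3 * R3_coord b n).
    by rewrite R3_coordE ?h3 //=.
  rewrite !c3 !c2 !c0 !cn; ring.
- have [h3|h3] := ltnP k.+4 n; last first.
    have d0 (a b : 'rV[K]_n.+2) : R3_coord (R3_br a b) k.+4 = 0.
      by rewrite R3_coordE //= ifN // -leqNgt.
    by rewrite !d0 addr0.
  have ck (a b : 'rV[K]_n.+2) : R3_coord (R3_br a b) k.+4 =
      R3_coord a k.+3 * R3_coord b 0 + k.+4%:R * (R3_coord a k.+4 * R3_coord b n).
    by rewrite R3_coordE ?h3 //=.
  have ck' (a b : 'rV[K]_n.+2) : R3_coord (R3_br a b) k.+3 =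
      R3_coord a k.+2 * R3_coord b 0 + k.+3%:R * (R3_coord a k.+3 * R3_coord b n).
    by rewrite R3_coordE ?(ltnW h3) //=; lia.
  rewrite !ck !ck' !c0 !cn -!natr1; ring.
Qed.

Definition R3 (K : fieldType) (n : nat) (hn : (3 <= n)%N) : leibnizAlg K :=
  LeibnizAlg (@R3_linl K n) (@R3_linr K n) (R3_leibniz hn).

(* Main.v *)
Require Import Defs.
From HB Require Import structures.
From mathcomp Require Import all_boot all_order all_algebra.
From mathcomp Require Import zify ring.

Set Implicit Arguments.
Unset Strict Implicit.
Unset Printing Implicit Defensive.

Import GRing.Theory.
Local Open Scope ring_scope.

(** Consider the curve [v(l) = exp(l R_{e_1}) x = x - l e_1 - sum_{k >= 2} l^k/k! e_{k+1}],
    which satisfies [[v(l), v(m)] = (l - m) v'(l)]. The elements of this curve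
    are characterised by bracket relations with each other and with [e_2], [y],
    so every automorphism permutes them; moreover it fixes [y] and rescales
    [e_2]. Hence a local automorphism [Phi] also maps the curve into itself, and
    linearity forces the reparametrisation to be affine:
    [Phi(v(l)) = v(a l + t)]. Comparing polynomials in [l] gives
    [Phi(v'(l)) = a v'(a l + t)], so [Phi] is multiplicative on the points of the
    curve. In characteristic zero these points, together with [e_2] and [y], span
    the algebra. *)

(** * Coordinate formulas for the bracket *)

Section Coordinates.
Variables (K : fieldType) (n : nat) (hn : (3 <= n)%N).
Implicit Types (u v w : 'rV[K]_n.+2) (k : nat).
Local Notation "u `# k" := (R3_coord u k) (at level 2, k at level 2).

Lemma coord_inj u v :
  (forall k, (k < n.+2)%N -> u`#k = v`#k) -> u = v.
Proof.
move=> h; apply/rowP => j; have := h j (ltn_ord j).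
by rewrite /R3_coord inord_val.
Qed.

Lemma coord_row (f : nat -> K) k :
  (k < n.+2)%N -> (\row_(j < n.+2) f j)`#k = f k.
Proof. by move=> h; rewrite /R3_coord mxE inordK. Qed.

Lemma coordZ a u k : (a *: u)`#k = a * u`#k.
Proof. by rewrite /R3_coord mxE. Qed.

Lemma coordN u k : (- u)`#k = - u`#k.
Proof. by rewrite /R3_coord mxE. Qed.

Lemma coord0 k : (0 : 'rV[K]_n.+2)`#k = 0.
Proof. by rewrite /R3_coord mxE. Qed.

Lemma coord_e i k : (k < n.+2)%N -> (R3_e K n i)`#k = (k.+1 == i)%:R.
Proof. by move=> h; rewrite /R3_coord mxE inordK. Qed.

Lemma br0 u v : (R3_br u v)`#0 = u`#0 * v`#n - u`#n * v`#0.
Proof. by rewrite (R3_coordE hn). Qed.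

Lemma br1 u v : (R3_br u v)`#1 = u`#1 * v`#(n.+1).
Proof. by rewrite (R3_coordE hn). Qed.

Lemma br2 u v : (R3_br u v)`#2 = u`#0 * v`#0 + 2%:R * (u`#2 * v`#n).
Proof. by rewrite (R3_coordE hn) /= ?hn //; lia. Qed.

Lemma brS u v k : (2 <= k)%N -> (k.+1 < n)%N ->
  (R3_br u v)`#(k.+1) = u`#k * v`#0 + k.+1%:R * (u`#(k.+1) * v`#n).
Proof.
move=> h2 kn; rewrite (R3_coordE hn); last by lia.
by do 3 (case: eqP => [?|_]; first lia); rewrite kn.
Qed.

Lemma brn u v : (R3_br u v)`#n = 0.
Proof. by rewrite (R3_coordE hn) // ltnn; do 2 (case: eqP => [?|_]; first lia). Qed.

Lemma brn1 u v : (R3_br u v)`#(n.+1) = 0.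
Proof.
rewrite (R3_coordE hn) //; do 2 (case: eqP => [?|_]; first lia).
by case: ifP => // ?; lia.
Qed.

(** The cases match the shapes of the bracket formulas [br0], [br1], [br2], [brS], [brn], [brn1];
    for [n = 3] the middle range is empty. *)
Lemma coordP u v : u`#0 = v`#0 -> u`#1 = v`#1 -> u`#2 = v`#2 ->
  (forall k, (2 <= k)%N -> (k.+1 < n)%N -> u`#(k.+1) = v`#(k.+1)) ->
  u`#n = v`#n -> u`#(n.+1) = v`#(n.+1) -> u = v.
Proof.
move=> h0 h1 h2 hk hn0 hn1; apply: coord_inj => k kn.
have [->|k0] := eqVneq k 0%N; first by [].
have [->|k1] := eqVneq k 1%N; first by [].
have [->|k2] := eqVneq k 2%N; first by [].
have [->|kn0] := eqVneq k n; first by [].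
have [->|kn1] := eqVneq k n.+1; first by [].
by case: k k0 k1 k2 kn0 kn1 kn => // k *; apply: hk; lia.
Qed.

(** * Basis vectors, the curve and its velocity *)

Local Notation e1 := (R3_e K n 1).
Local Notation e2 := (R3_e K n 2).
Local Notation ex := (R3_e K n n.+1).
Local Notation ey := (R3_e K n n.+2).

(* The coordinates of [v(l)], as polynomials in [l]; [e_{k+1}] is at position [k]. *)
Definition curve_poly k : {poly K} :=
  if k == 0%N then - 'X
  else if k == 1%N then 0
  else if (k < n)%N then - ((k`!)%:R^-1 *: 'X^k)
  else if k == n then 1 else 0.

Definition curve (l : K) : 'rV[K]_n.+2 := \row_(j < n.+2) (curve_poly j).[l].
Definition velocity (l : K) : 'rV[K]_n.+2 :=
  \row_(j < n.+2) (curve_poly j)^`().[l].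

Lemma curveE l k : (k < n.+2)%N -> (curve l)`#k = (curve_poly k).[l].
Proof.
by move=> h; rewrite /curve (coord_row (fun j => (curve_poly j).[l])).
Qed.

Lemma velocityE l k :
  (k < n.+2)%N -> (velocity l)`#k = (curve_poly k)^`().[l].
Proof.
by move=> h; rewrite /velocity (coord_row (fun j => (curve_poly j)^`().[l])).
Qed.

Lemma curve_poly_n : curve_poly n = 1.
Proof. by rewrite /curve_poly ltnn eqxx; do 2 (case: eqP => [?|_]; first lia). Qed.

Lemma curve_poly_n1 : curve_poly n.+1 = 0.
Proof.
rewrite /curve_poly; do 2 (case: eqP => [?|_]; first lia).
by case: ifP => ?; [lia|case: eqP => // ?; lia].
Qed.

Lemma curve_poly_mid k : (2 <= k)%N -> (k < n)%N ->
  curve_poly k = - ((k`!)%:R^-1 *: 'X^k).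
Proof.
by move=> k2 kn; rewrite /curve_poly kn; do 2 (case: eqP => [?|_]; first lia).
Qed.

Hypothesis hK : [pchar K] =i pred0.

Lemma natf_neq0 k : (0 < k)%N -> k%:R != 0 :> K.
Proof. by move/pcharf0P: hK => ->; rewrite lt0n. Qed.

Lemma fact_neq0 k : (k`!)%:R != 0 :> K.
Proof. by apply: natf_neq0; apply: fact_gt0. Qed.

Lemma curve0 l : (curve l)`#0 = - l.
Proof. by rewrite curveE // /curve_poly eqxx hornerN hornerX. Qed.

Lemma curve1 l : (curve l)`#1 = 0.
Proof. by rewrite curveE // /curve_poly /= horner0. Qed.

Lemma curve_mid l k : (2 <= k)%N -> (k < n)%N ->
  (curve l)`#k = - (l ^+ k / (k`!)%:R).
Proof.
move=> k2 kn; rewrite curveE; last by lia.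
by rewrite curve_poly_mid // hornerN hornerZ hornerXn mulrC.
Qed.

Lemma curven l : (curve l)`#n = 1.
Proof. by rewrite curveE // curve_poly_n hornerC. Qed.

Lemma curven1 l : (curve l)`#(n.+1) = 0.
Proof. by rewrite curveE // curve_poly_n1 horner0. Qed.

Lemma velocity0 l : (velocity l)`#0 = - 1.
Proof. by rewrite velocityE // /curve_poly eqxx derivN derivX hornerN hornerC. Qed.

Lemma velocity1 l : (velocity l)`#1 = 0.
Proof. by rewrite velocityE // /curve_poly /= deriv0 horner0. Qed.

Lemma velocity_mid l k : (1 <= k)%N -> (k.+1 < n)%N ->
  (velocity l)`#(k.+1) = - (l ^+ k / (k`!)%:R).
Proof.
move=> k2 kn; rewrite velocityE; last by lia.
rewrite curve_poly_mid // derivN derivZ derivXn hornerN hornerZ hornerMn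
  hornerXn /=.
rewrite factS natrM -[l ^+ k *+ _]mulr_natl.
move: (natf_neq0 (ltn0Sn k)) (fact_neq0 k).
by move: (k.+1%:R) ((k`!)%:R) => c d c0 d0; field; rewrite c0 d0.
Qed.

Lemma velocityn l : (velocity l)`#n = 0.
Proof. by rewrite velocityE // curve_poly_n derivC horner0. Qed.

Lemma velocityn1 l : (velocity l)`#(n.+1) = 0.
Proof. by rewrite velocityE // curve_poly_n1 deriv0 horner0. Qed.

(** * Brackets along the curve *)

Definition curveC := (curve0, curve1, curven, curven1,
  velocity0, velocity1, velocityn, velocityn1).

(** Since (k+1)/(k+1)! = 1/k!, coordinate k+1 of the bracket is (m - l) l^k/k!, and that of the
    velocity is -l^k/k!. *)
Lemma br_curve l m : R3_br (curve l) (curve m) = (l - m) *: velocity l.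
Proof.
apply: coordP => [||| k k2 kn||]; rewrite ?(br0, br1, br2, brn, brn1, coordZ, curveC).
- ring.
- ring.
- rewrite curve_mid // velocity_mid // (_ : 1`! = 1)%N // (_ : 2`! = 2)%N //.
  move: (natf_neq0 (ltn0Sn 1)).
  by move: 2%:R => c c0; rewrite divr1; field.
- rewrite brS // !curveC !curve_mid ?velocity_mid //; try lia.
  rewrite factS natrM exprS.
  move: (natf_neq0 (ltn0Sn k)) (fact_neq0 k).
  by move: (k.+1%:R) ((k`!)%:R) => c d c0 d0; field; rewrite c0 d0.
- by rewrite mulr0.
- by rewrite mulr0.
Qed.

(** Formally the derivative of [br_curve] in [l] at [m = l]; the next relation is its derivative in
    [m]. *)
Lemma br_velocity_curve l : R3_br (velocity l) (curve l) = velocity l.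
Proof.
apply: coordP => [||| k k2 kn||]; rewrite ?(br0, br1, br2, brn, brn1, curveC) //.
- ring.
- ring.
- by rewrite velocity_mid // (_ : 1`! = 1)%N // divr1 expr1; ring.
- rewrite brS // !curveC velocity_mid //; last by lia.
  case: k k2 kn => // k k2 kn; rewrite velocity_mid //; try lia.
  rewrite factS natrM exprS -[k.+2%:R]natr1.
  move: (natf_neq0 (ltn0Sn k)) (fact_neq0 k).
  by move: (k.+1%:R) ((k`!)%:R) => c d c0 d0; field; rewrite c0 d0.
Qed.

Lemma br_curve_velocity l : R3_br (curve l) (velocity l) = - velocity l.
Proof.
apply: coordP => [||| k k2 kn||];
  rewrite ?(br0, br1, br2, brn, brn1, coordN, curveC) ?oppr0 //.
- ring.
- ring.
- by rewrite velocity_mid // (_ : 1`! = 1)%N // divr1 expr1; ring.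
- rewrite brS // !curveC curve_mid ?velocity_mid //; try lia.
  ring.
Qed.

(** * Polynomial identities and the span of the curve *)

Lemma natf_inj : injective (fun k => k%:R : K).
Proof.
move=> i j; wlog ij : i j / (i <= j)%N => [h|] /= e.
  by case/orP: (leq_total i j) => [/h|/h h']; [exact|apply/esym/h'].
apply/eqP; rewrite eqn_leq ij /= -subn_eq0; apply: contraT.
by rewrite -lt0n => /natf_neq0; rewrite natrB // e subrr eqxx.
Qed.

(** In characteristic zero the integers give more distinct roots than a nonzero difference can
    have. *)
Lemma eq_poly_horner (p q : {poly K}) : (forall l, p.[l] = q.[l]) -> p = q.
Proof.
move=> h; apply/eqP; rewrite -subr_eq0; apply: contraT => pq0.
have := max_poly_roots pq0 (rs := [seq k%:R | k <- iota 0 (size (p - q))]).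
rewrite size_map size_iota ltnn (map_inj_uniq natf_inj) iota_uniq => -> //.
by apply/allP => x _; rewrite /root !hornerE h subrr.
Qed.

(** Coordinates along the image of the curve are kept as formal polynomials, so that identities in
    [l] can be compared by coefficients and differentiated. *)
Definition coord_poly (f : {linear 'rV[K]_n.+2 -> 'rV[K]_n.+2}) (j : nat) :
    {poly K} :=
  \sum_(i < n.+2) (f (R3_e K n i.+1))`#j *: curve_poly i.

Lemma linear_e (f : {linear 'rV[K]_n.+2 -> 'rV[K]_n.+2}) u :
  f u = \sum_(i < n.+2) u`#i *: f (R3_e K n i.+1).
Proof.
rewrite {1}[u]row_sum_delta linear_sum; apply: eq_bigr => i _.
rewrite linearZ /R3_coord inord_val; congr (_ *: f _).
by apply/rowP => j; rewrite !mxE eqxx eqSS.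
Qed.

Lemma coord_sum (I : finType) (F : I -> 'rV[K]_n.+2) k :
  (\sum_i F i)`#k = \sum_i (F i)`#k.
Proof. by rewrite /R3_coord summxE. Qed.

Lemma coord_polyE (f : {linear 'rV[K]_n.+2 -> 'rV[K]_n.+2}) j l :
  (coord_poly f j).[l] = (f (curve l))`#j.
Proof.
rewrite linear_e coord_sum horner_sum; apply: eq_bigr => i _.
by rewrite hornerZ coordZ curveE // mulrC.
Qed.

Lemma deriv_coord_polyE (f : {linear 'rV[K]_n.+2 -> 'rV[K]_n.+2}) j l :
  (coord_poly f j)^`().[l] = (f (velocity l))`#j.
Proof.
rewrite linear_e coord_sum raddf_sum horner_sum; apply: eq_bigr => i _.
by rewrite /= derivZ hornerZ coordZ velocityE // mulrC.
Qed.

(** These exponents are pairwise distinct away from positions 1 and n+1, where [curve_poly]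
    vanishes. *)
Definition curve_deg k : nat :=
  if k == 0%N then 1%N else if k == n then 0%N else k.

Lemma curve_poly_monomial k : (k < n.+1)%N -> k != 1%N ->
  exists2 c, c != 0 & curve_poly k = c *: 'X^(curve_deg k).
Proof.
move=> kn /negbTE k1; rewrite /curve_poly /curve_deg k1.
have [_|k0] := eqVneq k 0%N.
  by exists (- 1); rewrite ?oppr_eq0 ?oner_eq0 // scaleN1r.
have [->|kn0] := eqVneq k n; first by rewrite ltnn; exists 1;
  rewrite ?oner_eq0 ?scale1r.
have -> : (k < n)%N by lia.
by exists (- (k`!)%:R^-1); rewrite ?oppr_eq0 ?invr_eq0 ?fact_neq0 // scaleNr.
Qed.

(** Along the curve the basis vectors other than [e2] and [ey] carry monomials of distinct degrees,
    so vanishing there kills the image of each of them. *)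
Lemma eq0_generators (f : {linear 'rV[K]_n.+2 -> 'rV[K]_n.+2}) :
  (forall l, f (curve l) = 0) -> f e2 = 0 -> f ey = 0 -> forall u, f u = 0.
Proof.
move=> fc f2 fy u; rewrite linear_e; apply: big1 => i _.
apply/eqP; rewrite scaler_eq0; apply/orP; right; apply/eqP.
have [-> //|i1] := eqVneq (nat_of_ord i) 1%N.
have [-> //|in1] := eqVneq (nat_of_ord i) n.+1.
have lin : (i < n.+1)%N by have := ltn_ord i; lia.
apply: coord_inj => j _; rewrite coord0.
have P0 : coord_poly f j = 0.
  by apply: eq_poly_horner => l; rewrite coord_polyE fc coord0 horner0.
(* Only the term of index [i] contributes to this coefficient. *)
have := congr1 (fun p : {poly K} => p`_(curve_deg i)) P0.
rewrite coef0 coef_sum (bigD1 i) //= big1 => [|m mi].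
  have [c c0 ->] := curve_poly_monomial lin i1.
  rewrite addr0 !coefZ coefXn eqxx mulr1 => /eqP.
  by rewrite mulf_eq0 (negbTE c0) orbF => /eqP.
have [m1|m1] := eqVneq (nat_of_ord m) 1%N.
  by rewrite /curve_poly m1 /= scaler0 coef0.
have [mn1|mn1] := eqVneq (nat_of_ord m) n.+1.
  by rewrite mn1 curve_poly_n1 scaler0 coef0.
have lmn : (m < n.+1)%N by have := ltn_ord m; lia.
have [c c0 ->] := curve_poly_monomial lmn m1.
rewrite !coefZ coefXn; case: eqP => [e|_]; last by rewrite !mulr0.
move: mi; rewrite -(inj_eq val_inj) /=; move: e; rewrite /curve_deg.
by do ?(case: ifP => ?); move=> *; exfalso; lia.
Qed.

(** * Products with basis vectors; recognising points of the curve *)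

Ltac decide_nat_eq :=
  repeat match goal with
  | |- context [@eq_op _ ?a ?b] =>
    first [rewrite (_ : (a == b) = false); last by lia
          |rewrite (_ : (a == b) = true); last by lia]
  end.

Ltac br_basis :=
  apply: coordP => [||| k k2 kn||];
  rewrite ?(br0, br1, br2, brn, brn1) // ?brS // ?(coordZ, coord0) ?coord_e //;
  try lia; decide_nat_eq;
  rewrite ?(mul0r, mulr0, mul1r, mulr1, addr0, add0r, subr0, sub0r, oppr0) //.

Lemma br_eyl u : R3_br ey u = 0.
Proof. by br_basis. Qed.

Lemma br_ey u : R3_br u ey = u`#1 *: e2.
Proof. by br_basis. Qed.

Lemma br_e2 u : R3_br e2 u = u`#(n.+1) *: e2.
Proof. by br_basis. Qed.

Lemma br_e2r u : R3_br u e2 = 0.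
Proof. by br_basis. Qed.

Lemma br_e1_ex : R3_br e1 ex = e1.
Proof. by br_basis. Qed.

Lemma br_e1_e1 : R3_br e1 e1 = R3_e K n 3.
Proof. by br_basis. Qed.

Lemma br_e_e1 i : (3 <= i < n)%N -> R3_br (R3_e K n i) e1 = R3_e K n i.+1.
Proof.
by case/andP=> i3 lin; br_basis.
Qed.

(** With x-coordinate 1, the equation [w,w] = 0 is the recursion (k+1) w_{k+1} = -w_0 w_k, started
    by 2 w_2 = -w_0^2; division by k+1 leaves w_0 as the only free parameter. *)
Lemma curve_recognition w : w`#1 = 0 -> w`#n = 1 -> w`#(n.+1) = 0 ->
  R3_br w w = 0 -> w = curve (- w`#0).
Proof.
move=> w1 wn wn1 ww.
have w2 : 2%:R * w`#2 = - (w`#0 * w`#0).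
  have := congr1 (fun u => u`#2) ww; rewrite br2 coord0 wn mulr1 => /eqP.
  by rewrite addrC addr_eq0 => /eqP.
have wS k : (2 <= k)%N -> (k.+1 < n)%N -> k.+1%:R * w`#(k.+1) = - (w`#k * w`#0).
  move=> k2 kn; have := congr1 (fun u => u`#(k.+1)) ww.
  by rewrite brS // coord0 wn mulr1 => /eqP; rewrite addrC addr_eq0 => /eqP.
have wk k : (k.+2 < n)%N -> w`#(k.+2) = (curve (- w`#0))`#(k.+2).
  elim: k => [|k IH] kn.
    rewrite curve_mid // (_ : 2`! = 2)%N //.
    apply: (mulfI (natf_neq0 (ltn0Sn 1))); rewrite w2.
    by move: (natf_neq0 (ltn0Sn 1)); move: 2%:R => c c0; field.
  apply: (mulfI (natf_neq0 (ltn0Sn k.+2))); rewrite wS // IH; last by lia.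
  rewrite !curve_mid //; last by lia.
  rewrite (factS k.+2) natrM (exprS _ k.+2); move: (natf_neq0 (ltn0Sn k.+2)) (fact_neq0 k.+2).
  by move: (k.+3%:R) ((k.+2)`!%:R) => c d c0 d0; field; rewrite c0 d0.
apply: coordP => [||| k k2 kn||]; rewrite ?curveC ?opprK //; first exact: wk.
by case: k k2 kn => // k _ kn; apply: wk.
Qed.

(** * Action of automorphisms on [e2], [ey] and the curve *)

Section Automorphism.
Variable phi : {linear 'rV[K]_n.+2 -> 'rV[K]_n.+2}.
Hypotheses (phi_bij : bijective phi)
  (phi_br : forall u v, phi (R3_br u v) = R3_br (phi u) (phi v)).

(** Right multiplication by [e1] detects the x-coordinate, by [ey] that of [e2], and by [ex] the
    remaining e_i up to nonzero integers. *)
Lemma left_annihilator u : (forall v, R3_br u v = 0) -> u = u`#(n.+1) *: ey.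
Proof.
move=> h; have h1 k := congr1 (fun u => u`#k) (h e1).
have hx k := congr1 (fun u => u`#k) (h ex).
have hy k := congr1 (fun u => u`#k) (h ey).
move: (h1 0) (hx 0) (hx 2) (hy 1%N) => {h1}.
rewrite !br0 br1 br2 !coord0 !coord_e //; decide_nat_eq.
rewrite !(mulr0, mulr1, add0r, subr0, sub0r) => /eqP.
rewrite oppr_eq0 => /eqP un u0 /eqP.
rewrite mulf_eq0 (negbTE (natf_neq0 _)) //= => /eqP u2 u1.
apply: coordP => [||| k k2 kn||]; rewrite coordZ coord_e //; try lia;
  decide_nat_eq; rewrite ?(mulr0, mulr1) //.
have := hx k.+1; rewrite brS // coord0 !coord_e //; try lia; decide_nat_eq.
rewrite mulr0 add0r mulr1 => /eqP.
by rewrite mulf_eq0 (negbTE (natf_neq0 _)) // => /eqP.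
Qed.

Lemma aut_eq0 u : (phi u == 0) = (u == 0).
Proof. by rewrite -[0 in LHS](linear0 phi) (inj_eq (bij_inj phi_bij)). Qed.

Lemma e_neq0 i : (0 < i <= n.+2)%N -> R3_e K n i != 0.
Proof.
case: i => // i /= ilt; apply/eqP => /(congr1 (fun u => u`#i)).
by rewrite coord_e // coord0 eqxx => /eqP; rewrite oner_eq0.
Qed.

Lemma aut_ey_multiple : phi ey = (phi ey)`#(n.+1) *: ey.
Proof.
apply: left_annihilator => v; have [psi _ phiK] := phi_bij.
by rewrite -[v]phiK -phi_br br_eyl linear0.
Qed.

Lemma br_e2_ey : R3_br e2 ey = e2.
Proof. by rewrite br_ey coord_e // eqxx scale1r. Qed.

Lemma brZr u a v : R3_br u (a *: v) = a *: R3_br u v.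
Proof.
have h0 : R3_br u 0 = 0.
  by have := R3_linr u (- 1) 0 0; rewrite /= scaler0 addr0 scaleN1r addNr.
by have := R3_linr u a v 0; rewrite addr0 h0 addr0.
Qed.

Lemma brZl a u v : R3_br (a *: u) v = a *: R3_br u v.
Proof.
have h0 : R3_br 0 v = 0.
  by have := R3_linl v (- 1) 0 0; rewrite /= scaler0 addr0 scaleN1r addNr.
by have := R3_linl v a u 0; rewrite addr0 h0 addr0.
Qed.

(** Applying [phi] to [e_2,y] = e_2 gives phi(e_2) = c b e_2, hence b = c b; injectivity gives b !=
    0, so c = 1. *)
Lemma aut_e2_ey : phi e2 = (phi e2)`#1 *: e2 /\ phi ey = ey.
Proof.
set c := (phi ey)`#(n.+1); set b := (phi e2)`#1.
have g_eq : phi e2 = c *: (b *: e2).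
  by rewrite -{1}br_e2_ey phi_br aut_ey_multiple brZr br_ey.
have bc : b = c * b.
  by rewrite {1}/b g_eq !coordZ coord_e // eqxx mulr1.
have g_eq' : phi e2 = b *: e2 by rewrite g_eq scalerA -bc.
have b0 : b != 0.
  apply: contraTneq (e_neq0 (isT : (0 < 2 <= n.+2)%N)) => b0.
  by rewrite negbK -aut_eq0 g_eq' b0 scale0r.
split=> //; rewrite aut_ey_multiple -/c (_ : c = 1) ?scale1r //.
by apply: (mulIf b0); rewrite -bc mul1r.
Qed.

Lemma aut_e2_neq0 : (phi e2)`#1 != 0.
Proof.
apply: contraTneq (e_neq0 (isT : (0 < 2 <= n.+2)%N)) => b0.
by rewrite negbK -aut_eq0 aut_e2_ey.1 b0 scale0r.
Qed.

(** The images of the point and its velocity satisfy the same brackets with each other, with [ey]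
    and with a nonzero multiple of [e2]; these give the hypotheses of [curve_recognition]. *)
Lemma aut_curve l : exists m, phi (curve l) = curve m.
Proof.
set w := phi (curve l); set d := phi (velocity l).
have dw : R3_br d w = d by rewrite -phi_br br_velocity_curve.
have wd : R3_br w d = - d by rewrite -phi_br br_curve_velocity linearN.
have [e2E eyE] := aut_e2_ey.
have d0 : d != 0.
  rewrite aut_eq0; apply/eqP => /(congr1 (fun u => u`#0)).
  by rewrite velocity0 coord0 => /eqP; rewrite oppr_eq0 oner_eq0.
have dn : d`#n = 0 by rewrite -dw brn.
have dn1 : d`#(n.+1) = 0 by rewrite -dw brn1.
have w_n : w`#n = 1.
  have : d`#0 * w`#n = d`#0 by rewrite -{2}dw br0 dn mul0r subr0.
  have [d00|d00] := eqVneq d`#0 0; last first.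
    by move=> h; apply: (mulfI d00); rewrite h mulr1.
  (* A right factor acts only through its coordinates 0, n and n+1. All three vanish for [d] here,
     so [w,d] = 0, although [w,d] = -d with d nonzero. *)
  case/eqP: d0; apply: oppr_inj; rewrite oppr0 -wd.
  by apply: coordP => [||| k k2 kn||];
    rewrite ?(br0, br1, br2, brn, brn1) // ?brS // coord0 ?d00 ?dn ?dn1;
    rewrite ?(mulr0, addr0, subr0).
have w_1 : w`#1 = 0.
  have : R3_br w ey = 0 by rewrite -eyE -phi_br br_ey curve1 scale0r linear0.
  rewrite br_ey => /eqP; rewrite scaler_eq0 (negbTE (e_neq0 _)) // orbF.
  by move/eqP.
have w_n1 : w`#(n.+1) = 0.
  have : R3_br (phi e2) w = 0 by rewrite -phi_br br_e2 curven1 scale0r linear0.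
  rewrite e2E brZl br_e2 => /eqP.
  rewrite !scaler_eq0 (negbTE aut_e2_neq0) (negbTE (e_neq0 _)) //= orbF.
  by move/eqP.
exists (- w`#0); apply: curve_recognition => //.
by rewrite -phi_br br_curve subrr scale0r linear0.
Qed.

(** Each such e_i is a product of factors that are themselves products, as e_1 = [e_1,x]. Their
    images have no x-coordinate, and then [br0] vanishes. *)
Lemma aut_e_coord0 i : (3 <= i <= n)%N -> (phi (R3_e K n i))`#0 = 0.
Proof.
have en u v : (phi (R3_br u v))`#n = 0 by rewrite phi_br brn.
have e1n : (phi e1)`#n = 0 by rewrite -br_e1_ex en.
case: i => [|[|[|[|i]]]] // /andP[_ lin].
  by rewrite -br_e1_e1 phi_br br0 e1n mulr0 mul0r subrr.
have ein : (phi (R3_e K n i.+3))`#n = 0.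
  case: i lin => [|i] lin; first by rewrite -br_e1_e1 en.
  by rewrite -br_e_e1 ?en //; lia.
rewrite -br_e_e1; last by lia.
by rewrite phi_br br0 e1n ein mulr0 mul0r subrr.
Qed.

End Automorphism.

(** * Local automorphisms *)

Section LocalAutomorphism.
Variable Phi : {linear 'rV[K]_n.+2 -> 'rV[K]_n.+2}.
Hypothesis Phi_local : forall u, exists phi : {linear 'rV[K]_n.+2 -> 'rV[K]_n.+2},
  [/\ bijective phi, forall v w, phi (R3_br v w) = R3_br (phi v) (phi w)
    & Phi u = phi u].

(** Slope and shift of the reparametrisation; the sign in [t] reflects that [curve l] has first
    coordinate -l. *)
Let a := (Phi e1)`#0.
Let t := - (Phi ex)`#0.
Let b := (Phi e2)`#1.

Lemma local_ey : Phi ey = ey.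
Proof. by have [phi [bij hom ->]] := Phi_local ey; case: (aut_e2_ey bij hom). Qed.

Lemma local_e2 : Phi e2 = b *: e2.
Proof.
rewrite /b; have [phi [bij hom ->]] := Phi_local e2.
by case: (aut_e2_ey bij hom).
Qed.

(** By [aut_e_coord0] only the components -l e_1 and x of the curve contribute, hence an affine
    function of [l]. *)
Lemma local_curve_coord0 l : (Phi (curve l))`#0 = - (a * l + t).
Proof.
rewrite linear_e coord_sum (bigD1 ord0) //= (bigD1 (inord n)); last first.
  by rewrite -(inj_eq val_inj) /= inordK //; lia.
rewrite big1 /= => [|i /andP[i0 iN]].
  by rewrite inordK // !coordZ !curveC /t /a; ring.
have {}i0 : nat_of_ord i <> 0%N by move/eqP: i0 => h e; apply: h; apply: val_inj.
have {}iN : nat_of_ord i <> n.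
  by move/eqP: iN => h e; apply: h; apply: val_inj; rewrite /= inordK.
rewrite coordZ.
have [->|i1] := eqVneq (nat_of_ord i) 1%N; first by rewrite curve1 mul0r.
have [->|in1] := eqVneq (nat_of_ord i) n.+1; first by rewrite curven1 mul0r.
have lin := ltn_ord i.
have [phi [bij hom ->]] := Phi_local (R3_e K n i.+1).
by rewrite aut_e_coord0 ?mulr0 //; lia.
Qed.

(** The automorphism agreeing with [Phi] at this point depends on [l], but the parameter of the
    image is read off from its first coordinate. *)
Lemma local_curve l : Phi (curve l) = curve (a * l + t).
Proof.
have := local_curve_coord0 l.
have [phi [bij hom ->]] := Phi_local (curve l).
have [m ->] := aut_curve bij hom l.
by rewrite curve0 => /oppr_inj ->.
Qed.

(** By [eq_poly_horner], [local_curve] is an identity of polynomials in [l]; the chain rule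
    differentiates it. *)
Lemma local_velocity l : Phi (velocity l) = a *: velocity (a * l + t).
Proof.
apply: coord_inj => k kn.
have PE : coord_poly Phi k = curve_poly k \Po (a *: 'X + t%:P).
  apply: eq_poly_horner => m.
  by rewrite coord_polyE local_curve curveE // horner_comp !hornerE.
rewrite -deriv_coord_polyE PE deriv_comp hornerM horner_comp coordZ velocityE //.
by rewrite derivD derivZ derivX derivC !hornerE mulrC.
Qed.

Lemma linear_br_defect_l w :
  linear (fun u => Phi (R3_br u w) - R3_br (Phi u) (Phi w)).
Proof.
by move=> c u v; rewrite R3_linl !linearP R3_linl scalerBr opprD addrACA.
Qed.

Lemma linear_br_defect_r u :
  linear (fun w => Phi (R3_br u w) - R3_br (Phi u) (Phi w)).
Proof.
by move=> c v w; rewrite R3_linr !linearP R3_linr scalerBr opprD addrACA.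
Qed.

(** The defect of multiplicativity is bilinear, so [eq0_generators] in each argument reduces to
    curve points, [e2] and [ey]. *)
Lemma local_br u w : Phi (R3_br u w) = R3_br (Phi u) (Phi w).
Proof.
pose L w : {linear 'rV[K]_n.+2 -> 'rV[K]_n.+2} := HB.pack
  (fun u => Phi (R3_br u w) - R3_br (Phi u) (Phi w))
  (GRing.isLinear.Build _ _ _ _ _ (linear_br_defect_l w)).
pose R u : {linear 'rV[K]_n.+2 -> 'rV[K]_n.+2} := HB.pack
  (fun w => Phi (R3_br u w) - R3_br (Phi u) (Phi w))
  (GRing.isLinear.Build _ _ _ _ _ (linear_br_defect_r u)).
apply/eqP; rewrite -subr_eq0; apply/eqP.
apply: (eq0_generators (f := L w)) => [l||] /=.
- apply: (eq0_generators (f := R (curve l))) => [m||] /=.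
  (* The shift [t] cancels in the difference of parameters, leaving a (l - m) on both sides. *)
  + rewrite br_curve linearZ /= local_velocity !local_curve br_curve scalerA.
    by rewrite -scalerBl (_ : _ - _ = 0) ?scale0r //; ring.
  + by rewrite local_e2 brZr !br_e2r scaler0 linear0 subrr.
  + by rewrite local_ey local_curve !br_ey !curve1 !scale0r linear0 subrr.
- apply: (eq0_generators (f := R e2)) => [m||] /=.
  + rewrite local_e2 local_curve brZl !br_e2 !curven1 !scale0r scaler0 linear0.
    exact: subrr.
  + by rewrite local_e2 brZr !br_e2r scaler0 linear0 subrr.
  + by rewrite local_ey br_e2_ey local_e2 brZl br_e2_ey subrr.
- by rewrite local_ey !br_eyl linear0 subrr.
Qed.

(** Agreement at each vector with an injective map makes the kernel trivial, which suffices in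
    finite dimension. *)
Lemma local_bijective : bijective Phi.
Proof.
have ker0 u : Phi u = 0 -> u = 0.
  have [phi [bij _ ->]] := Phi_local u.
  by move/eqP; rewrite (aut_eq0 bij) => /eqP.
have PhiE u : Phi u = u *m lin1_mx Phi by rewrite mul_rV_lin1.
have M_unit : lin1_mx Phi \in unitmx.
  by rewrite -row_free_unit; apply: inj_row_free => v; rewrite -PhiE => /ker0.
by exists (fun u => u *m invmx (lin1_mx Phi)) => u;
  rewrite PhiE ?mulmxK ?mulmxKV.
Qed.

End LocalAutomorphism.
End Coordinates.

Theorem theorem3p4 (K : fieldType) (hK : [pchar K] =i pred0)
    (n : nat) (hn : (3 <= n)%N)
    (Phi : {linear R3 K hn -> R3 K hn}) :
  local_automorphism Phi -> automorphism Phi.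
Proof.
move=> Phi_local.
have Phi_local' u : exists phi : {linear 'rV[K]_n.+2 -> 'rV[K]_n.+2},
    [/\ bijective phi, forall v w, phi (R3_br v w) = R3_br (phi v) (phi w)
      & (Phi : {linear 'rV[K]_n.+2 -> 'rV[K]_n.+2}) u = phi u].
  by have [phi [[bij hom] e]] := Phi_local u; exists phi.
split; first exact: (local_bijective Phi_local').
exact: (local_br hn hK Phi_local').
Qed.
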